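(* Let $H=(V,E)$ be a connected hypergraph without empty edges. Then: (1) The intersection of any two distinct blocks of $H$ contains no edges and at most one vertex. (2) The blocks of $H$ form a decomposition of $H$ (every edge of $H$ lies in exactly one block and $H$ is the union of its blocks). (3) For any cycle $C$ of $H$, the hypersubgraph $\mathcal{H}(C)$ associated with $C$ is contained within a block of $H$.
   Context: A hypergraph $H=(V,E)$ consists of a nonempty finite vertex set $V$, a finite edge set $E$, and an incidence function $\psi:E\to 2^V$; edges are identified with their vertex sets (parallel edges allowed); an empty edge has empty vertex set. Two distinct vertices are adjacent via $e$ if both lie in $e$; a walk is a sequence $v_0e_1v_1\dots e_kv_k$ with $v_{i-1},v_i$ adjacent via $e_i$; $H$ is connected if any two distinct vertices are joined by a walk. A cycle is a walk $v_0e_1v_1\dots e_kv_k$ with $k\ge2$, $v_0=v_k$, $v_0,\dots,v_{k-1}$ pairwise distinct and $e_1,\dots,e_k$ pairwise distinct; $\mathcal{H}(C)$ is the hypersubgraph with edge set $\{e_1,\dots,e_k\}$ and vertex set $e_1\cup\dots\cup e_k$. A hypersubgraph of $H$ is a hypergraph $(V',E')$ with $\emptyset\ne V'\subseteq V$, $E'\subseteq E$. A vertex $v$ is a separating vertex of a connected hypergraph $K$ without empty edges if there are two connected hypersubgraphs $K_1,K_2$ of $K$, each with at least one edge, with $E(K_1)\cap E(K_2)=\emptyset$, $V(K)=V(K_1)\cup V(K_2)$, $E(K)=E(K_1)\cup E(K_2)$, and $V(K_1)\cap V(K_2)=\{v\}$. A hypergraph is non-separable if it is connected, has no empty edges and has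 no separating vertices. A block of $H$ is a maximal non-separable hypersubgraph of $H$. *)

(* Defs.v *)
From mathcomp Require Import all_boot.

Set Implicit Arguments.
Unset Strict Implicit.
Unset Printing Implicit Defensive.

(* The incidence function psi : E -> {set V} is fixed on ambient finite types
   V and E, and a hypergraph is a pair of a nonempty vertex set and an edge set
   drawn from them, such that every edge of the hypergraph only has vertices of
   the hypergraph. Any finite hypergraph (V, E, psi) arises with vset and eset
   the full sets, and its hypersubgraphs are then values of the same type. Since
   psi need not be injective, parallel edges are allowed. The two conditions
   are boolean, so hypergraphs with equal vset and eset are equal. *)
Record hypergraph (V E : finType) (psi : E -> {set V}) := Hypergraph {
  vset : {set V};
  eset : {set E};
  vset_neq0 : vset != set0;
  eset_sub : [forall e in eset, psi e \subset vset]
}.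

Section Hypergraphs.
Context {V E : finType} {psi : E -> {set V}}.
Implicit Types (H K B : hypergraph psi) (u v : V) (e : E) (s : seq (E * V)).

Definition hypersubgraph K H : bool :=
  (vset K \subset vset H) && (eset K \subset eset H).

Definition no_empty_edges H : Prop := forall e, e \in eset H -> psi e != set0.

Definition adjacent_via H e u v : bool :=
  [&& e \in eset H, u != v, u \in psi e & v \in psi e].

(* The walk v_0 e_1 v_1 ... e_k v_k is represented by v_0 and the sequence
   [:: (e_1, v_1); ...; (e_k, v_k)]. *)
Fixpoint is_walk H v s : bool :=
  if s is (e, u) :: s' then adjacent_via H e v u && is_walk H u s'
  else v \in vset H.

Definition walk_end v s : V := last v (unzip2 s).

Definition connected H : Prop :=
  forall u v, u \in vset H -> v \in vset H -> u != v ->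
    exists s, is_walk H u s /\ walk_end u s = v.

(* belast v_0 [:: v_1; ...; v_k] is [:: v_0; ...; v_(k-1)]. *)
Definition is_cycle H v s : bool :=
  [&& is_walk H v s, 2 <= size s, walk_end v s == v,
      uniq (belast v (unzip2 s)) & uniq (unzip1 s)].

Record cycle_of H := CycleOf {
  cycle_start : V;
  cycle_steps : seq (E * V);
  cycle_ofP : is_cycle H cycle_start cycle_steps
}.

Definition cycle_eset H (C : cycle_of H) : {set E} :=
  [set e in unzip1 (cycle_steps C)].

Definition cycle_vset H (C : cycle_of H) : {set V} :=
  \bigcup_(e in cycle_eset C) psi e.

Lemma cycle_vset_neq0 H (C : cycle_of H) : cycle_vset C != set0.
Proof.
case: C => v [|[e u] s] P; first by move/and5P: (P) => [].
have /and5P[/= /andP[/and4P[_ _ ve _] _] _ _ _ _] := P.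
apply/set0Pn; exists v; apply/bigcupP; exists e => //.
by rewrite inE /= mem_head.
Qed.

Lemma cycle_eset_sub H (C : cycle_of H) :
  [forall e in cycle_eset C, psi e \subset cycle_vset C].
Proof. by apply/forall_inP => e eC; apply: bigcup_sup. Qed.

Definition cycle_hypergraph H (C : cycle_of H) : hypergraph psi :=
  Hypergraph (cycle_vset_neq0 C) (cycle_eset_sub C).

(* Only meaningful for K connected and without empty edges. *)
Definition separating_vertex K v : Prop :=
  exists K1 K2 : hypergraph psi,
    [/\ hypersubgraph K1 K /\ hypersubgraph K2 K,
        connected K1 /\ connected K2,
        eset K1 != set0 /\ eset K2 != set0
      & [/\ eset K1 :&: eset K2 = set0,
            vset K = vset K1 :|: vset K2,
            eset K = eset K1 :|: eset K2
          & vset K1 :&: vset K2 = [set v]]].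

Definition nonseparable K : Prop :=
  [/\ connected K, no_empty_edges K & ~ exists v, separating_vertex K v].

Definition block H B : Prop :=
  [/\ hypersubgraph B H, nonseparable B
    & forall B', hypersubgraph B' H -> nonseparable B' ->
        hypersubgraph B B' -> B' = B].

Definition decomposition H (F : hypergraph psi -> Prop) : Prop :=
  [/\ forall B, F B -> hypersubgraph B H,
      forall e, e \in eset H -> exists! B, F B /\ e \in eset B,
      forall v, v \in vset H <-> exists B, F B /\ v \in vset B
    & forall e, e \in eset H <-> exists B, F B /\ e \in eset B].

End Hypergraphs.

(* Main.v *)
Require Import Defs.
From mathcomp Require Import all_boot.
From Stdlib Require Import Classical.

Set Implicit Arguments.
Unset Strict Implicit.
Unset Printing Implicit Defensive.

(** A nonseparable hypersubgraph B of K lies entirely on one side of any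
    separation (K1, K2) of K at a vertex x: otherwise B /\ K1 and B /\ K2 would
    separate B at x. Hence the union of two nonseparable hypersubgraphs that
    share an edge or two vertices is nonseparable, which by maximality gives
    (1). Single edges and single vertices are nonseparable, so each extends to
    a block, which gives (2). In a cycle, consecutive edges on different sides
    of a separation at x can only meet at x, and x is visited at most once, so
    the cycle cannot be separated; extending it to a block gives (3). *)

Section Blocks.
Context {V E : finType} {psi : E -> {set V}}.
Implicit Types (H K B : hypergraph psi) (u v x y : V) (e f : E).
Implicit Types (S : {set V}) (F : {set E}) (s : seq (E * V)).

(** * Hypersubgraph order, and connectedness through closed vertex sets *)

Lemma hypergraph_eq H K : vset H = vset K -> eset H = eset K -> H = K.
Proof.
case: H K => [A F A0 FA] [A' F' A0' FA'] /= eqA eqF.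
case: A' / eqA in A0' FA' *; case: F' / eqF in FA' *.
by congr Hypergraph; apply: bool_irrelevance.
Qed.

Lemma edge_subset H e : e \in eset H -> psi e \subset vset H.
Proof. by move=> eH; apply: (forall_inP (eset_sub H)). Qed.

Lemma mem_edge H e v : e \in eset H -> v \in psi e -> v \in vset H.
Proof. by move=> /edge_subset/subsetP; apply. Qed.

Lemma hypersubgraph_refl H : hypersubgraph H H.
Proof. by rewrite /hypersubgraph !subxx. Qed.

Lemma hypersubgraph_trans K H B :
  hypersubgraph H K -> hypersubgraph K B -> hypersubgraph H B.
Proof.
move=> /andP[HKv HKe] /andP[KBv KBe].
by rewrite /hypersubgraph (subset_trans HKv) // (subset_trans HKe).
Qed.

(** No edge of [F] crosses the boundary of [S]. The edge set is a parameter, so that the edges of a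
    part or of a walk can be used as well. *)
Definition edge_closed F S : Prop :=
  forall e v, e \in F -> v \in psi e -> v \in S -> psi e \subset S.

Lemma walk_closed H S u s : edge_closed (eset H) S -> is_walk H u s ->
  u \in S -> walk_end u s \in S.
Proof.
move=> clS; elim: s u => [|[e w] s IHs] u //=.
move=> /andP[/and4P[eH _ ue we] /IHs ws] uS.
by apply: ws; apply: (subsetP (clS e u eH ue uS)).
Qed.

(** Trades walks for closure arguments, so that restricting and merging hypergraphs needs no surgery
    on walks. *)
Lemma connectedP H : connected H <->
  forall S u, edge_closed (eset H) S -> u \in vset H -> u \in S ->
    vset H \subset S.
Proof.
split=> [Hconn S u clS uH uS | Hcl u v uH vH neq_uv].
  apply/subsetP => v vH; have [<- //|neq_uv] := eqVneq u v.
  have [s [us <-]] := Hconn u v uH vH neq_uv.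
  exact: walk_closed us uS.
pose r := [rel a b | [exists e, adjacent_via H e a b]].
(* The set reachable from [u] is edge-closed; a path in [r] then becomes a walk by choosing an edge
   for each step. *)
have: v \in [set w | connect r u w].
  apply: (subsetP (Hcl _ u _ uH _)) => //; last by rewrite inE connect0.
  move=> e w eH we; rewrite inE => uw; apply/subsetP => z ze.
  rewrite inE; have [<- //|neq_wz] := eqVneq w z.
  apply: connect_trans uw (connect1 _); apply/existsP; exists e.
  by apply/and4P.
rewrite inE => /connectP[p rp ->].
elim: p u uH rp {neq_uv} => [|w p IHp] u uH /=; first by exists [::].
case/andP=> /existsP[e euw] rp.
have wH: w \in vset H by case/and4P: euw => eH _ _ /(mem_edge eH).
have [s [ws <-]] := IHp w wH rp.
by exists ((e, w) :: s); rewrite /= euw ws.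
Qed.

(* Unlike in [separating_vertex], K1 and K2 need not be connected or have
   edges: locating nonseparable pieces uses only the cut at [x]. *)
Definition separation K (K1 K2 : hypergraph psi) x : Prop :=
  [/\ vset K = vset K1 :|: vset K2, eset K = eset K1 :|: eset K2,
      eset K1 :&: eset K2 = set0 & vset K1 :&: vset K2 = [set x]].

Lemma separationC K (K1 K2 : hypergraph psi) x :
  separation K K1 K2 x -> separation K K2 K1 x.
Proof. by case=> ? ? ? ?; split; rewrite 1?setUC // setIC. Qed.

(** * Position of a hypersubgraph relative to a separation *)

Section Side.
Variables (K K1 K2 B : hypergraph psi) (x : V).
Hypotheses (sepK : separation K K1 K2 x) (BK : hypersubgraph B K).

Lemma separation_meet v : v \in vset K1 -> v \in vset K2 -> v = x.
Proof.
case: sepK => _ _ _ capx v1 v2.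
by apply/set1P; rewrite -capx inE v1.
Qed.

Lemma separation_edge e : e \in eset B -> e \in eset K1 \/ e \in eset K2.
Proof.
case: sepK => _ eqE _ _ eB; case/andP: BK => _ /subsetP/(_ e eB).
by rewrite eqE => /setUP.
Qed.

Lemma restrict_vset_neq0 :
  no_empty_edges B -> eset B :&: eset K1 != set0 ->
  vset B :&: vset K1 != set0.
Proof.
move=> neB /set0Pn[e /setIP[eB e1]]; have /set0Pn[v ve] := neB e eB.
by apply/set0Pn; exists v; rewrite inE !(mem_edge _ ve).
Qed.

Lemma restrict_eset_sub :
  [forall e in eset B :&: eset K1, psi e \subset vset B :&: vset K1].
Proof.
apply/forall_inP => e /setIP[eB e1].
by rewrite subsetI !edge_subset.
Qed.

(* A set closed under the edges of B inside K1 is closed under those of B once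
   V(K2) is added to it if it contains the cut vertex. *)
Lemma restrict_connected (neq0 : vset B :&: vset K1 != set0) :
  connected B -> connected (Hypergraph neq0 restrict_eset_sub).
Proof.
move=> /connectedP Bcl; apply/connectedP => S u clS /= /setIP[uB u1] uS.
pose S' := (S :&: vset K1) :|: (if x \in S then vset K2 else set0).
have inS' v : v \in S' -> v \in vset K1 -> v \in S.
  case/setUP=> [/setIP[] //|]; case: ifP => [xS v2 v1|_]; last by rewrite inE.
  by rewrite (separation_meet v1 v2).
have BS' : vset B \subset S'.
  apply: (Bcl S' u) => //; last by rewrite !inE uS u1.
  move=> e v eB ve vS'; have [e1|e2] := separation_edge eB.
    have vS := inS' v vS' (mem_edge e1 ve).
    rewrite subsetU // subsetI edge_subset // andbT.
    by rewrite (clS e v) //= inE eB.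
  (* If [x] is in [S], the whole edge lies in [vset K2], a part of [S']. Otherwise it would meet [S]
     inside [vset K1], hence at [x]. *)
  move: vS'; rewrite /S'; case: ifP => [_ _|xS].
    by rewrite subsetU // (edge_subset e2) orbT.
  rewrite setU0 => /setIP[vS v1].
  by rewrite -(separation_meet v1 (mem_edge e2 ve)) vS in xS.
by apply/subsetP => v /setIP[vB v1]; apply: inS' v1; apply: (subsetP BS').
Qed.

(** If [B] missed [x], no edge of [B] could leave [vset K1], so all of [B] would lie there; but a
    vertex of an edge in [K2] would then be [x]. *)
Lemma cut_vertex_mem : connected B -> no_empty_edges B ->
  eset B :&: eset K1 != set0 -> eset B :&: eset K2 != set0 -> x \in vset B.
Proof.
move=> /connectedP Bcl neB.
move=> /set0Pn[e1 /setIP[e1B e11]] /set0Pn[e2 /setIP[e2B e22]].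
have /set0Pn[v ve1] := neB _ e1B; have /set0Pn[w we2] := neB _ e2B.
apply/negPn/negP => xB.
have BK1 : vset B \subset vset K1.
  apply: (Bcl _ v) (mem_edge e1B ve1) (mem_edge e11 ve1) => e y eB ye y1.
  case: (separation_edge eB) => [|eK2]; first exact: edge_subset.
  by rewrite -(separation_meet y1 (mem_edge eK2 ye)) (mem_edge eB ye) in xB.
have wB := mem_edge e2B we2.
by rewrite -(separation_meet (subsetP BK1 w wB) (mem_edge e22 we2)) wB in xB.
Qed.

(** All edges of [B] are in [K1], and connectedness reaches every vertex of [B] through them from a
    vertex of one of these edges. *)
Lemma subset_side : connected B -> no_empty_edges B -> eset B != set0 ->
  eset B :&: eset K2 = set0 -> hypersubgraph B K1.
Proof.
move=> /connectedP Bcl neB /set0Pn[e eB] B2.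
have B1 : eset B \subset eset K1.
  apply/subsetP => f fB; case: (separation_edge fB) => // f2.
  by have := in_set0 f; rewrite -B2 inE fB f2.
have /set0Pn[v ve] := neB e eB.
rewrite /hypersubgraph B1 andbT.
apply: (Bcl _ v) (mem_edge eB ve) (mem_edge (subsetP B1 e eB) ve) => f y fB _ _.
by rewrite edge_subset // (subsetP B1).
Qed.

End Side.

Lemma nonseparable_side K K1 K2 B x : separation K K1 K2 x ->
  hypersubgraph B K -> nonseparable B ->
  hypersubgraph B K1 \/ hypersubgraph B K2.
Proof.
move=> sepK BK [Bconn neB nosep]; have sepK' := separationC sepK.
(* Without edges every set is closed, so a side holding one vertex of [B] holds them all. *)
have [B0|Bn0] := eqVneq (eset B) set0.
  have /set0Pn[u uB] := vset_neq0 B.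
  have sub (K' : hypergraph psi) : u \in vset K' -> hypersubgraph B K'.
    move=> uK'; rewrite /hypersubgraph B0 sub0set andbT.
    by apply: (proj1 (connectedP B) Bconn _ u) => // e v; rewrite B0 inE.
  case: (sepK) => eqV _ _ _; case/andP: BK => /subsetP/(_ u uB) + _.
  by rewrite eqV => /setUP[]/sub; [left | right].
have [B2|B2] := eqVneq (eset B :&: eset K2) set0.
  by left; apply: (subset_side sepK).
have [B1|B1] := eqVneq (eset B :&: eset K1) set0.
  by right; apply: (subset_side sepK').
case: nosep; exists x.
(* Makes the two restrictions of [B] meet in exactly [x] instead of nowhere. *)
have xB := cut_vertex_mem sepK BK Bconn neB B1 B2.
exists (Hypergraph (restrict_vset_neq0 neB B1) (restrict_eset_sub K1 B)).
exists (Hypergraph (restrict_vset_neq0 neB B2) (restrict_eset_sub K2 B)).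
case: (sepK) => eqV eqE capE capV; case/andP: (BK) => BV BE.
split=> //=; first by rewrite /hypersubgraph /= !subsetIl.
- by split; [apply: restrict_connected sepK _ _ _
            | apply: restrict_connected sepK' _ _ _].
- split.
  + by rewrite setIACA capE setI0.
  + by rewrite -setIUr -eqV; apply/esym/setIidPl.
  + by rewrite -setIUr -eqE; apply/esym/setIidPl.
  + by rewrite setIACA capV setIid; apply/setIidPr; rewrite sub1set.
Qed.

Lemma separating_vertexW K x : separating_vertex K x ->
  exists K1 K2 : hypergraph psi,
    [/\ separation K K1 K2 x, eset K1 != set0 & eset K2 != set0].
Proof. by case=> K1 [K2 [_ _ [? ?] []]]; exists K1, K2. Qed.

(** * Unions of nonseparable hypergraphs *)

Section Union.
Variables B1 B2 : hypergraph psi.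

Lemma union_vset_neq0 : vset B1 :|: vset B2 != set0.
Proof. by rewrite setU_eq0 negb_and vset_neq0. Qed.

Lemma union_eset_sub :
  [forall e in eset B1 :|: eset B2, psi e \subset vset B1 :|: vset B2].
Proof.
apply/forall_inP => e /setUP[] /edge_subset eB; rewrite subsetU // eB //.
by rewrite orbT.
Qed.

Definition hypergraph_union : hypergraph psi :=
  Hypergraph union_vset_neq0 union_eset_sub.

Lemma hypersubgraph_unionl : hypersubgraph B1 hypergraph_union.
Proof. by rewrite /hypersubgraph !subsetUl. Qed.

Lemma hypersubgraph_unionr : hypersubgraph B2 hypergraph_union.
Proof. by rewrite /hypersubgraph !subsetUr. Qed.

Lemma connected_union v : v \in vset B1 -> v \in vset B2 ->
  connected B1 -> connected B2 -> connected hypergraph_union.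
Proof.
move=> v1 v2 /connectedP cl1 /connectedP cl2.
apply/connectedP => S u clS /= uU uS.
have clS1 : edge_closed (eset B1) S by move=> e w e1; apply: clS; rewrite inE e1.
have clS2 : edge_closed (eset B2) S.
  by move=> e w e2; apply: clS; rewrite inE e2 orbT.
have vS : v \in S.
  case/setUP: uU => uB; first by apply: (subsetP (cl1 S u clS1 uB uS)).
  by apply: (subsetP (cl2 S u clS2 uB uS)).
by rewrite subUset (cl1 S v) ?(cl2 S v).
Qed.

(** In a separation of the union each [Bi] lies on one side. On opposite sides they share no edge
    and at most the cut vertex ([apart]); on a common side they leave the other without edges
    ([same]). *)
Lemma nonseparable_union : nonseparable B1 -> nonseparable B2 ->
  eset B1 :&: eset B2 != set0 \/ 1 < #|vset B1 :&: vset B2| ->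
  nonseparable hypergraph_union.
Proof.
move=> ns1 ns2 share; have [conn1 ne1 _] := ns1; have [conn2 ne2 _] := ns2.
have [v /setIP[v1 v2]] : exists v, v \in vset B1 :&: vset B2.
  case: share => [/set0Pn[e /setIP[e1 e2]]|/ltnW/card_gt0P //].
  have /set0Pn[v ve] := ne1 e e1.
  by exists v; rewrite inE !(mem_edge _ ve).
split; first exact: connected_union v1 v2 conn1 conn2.
  by move=> e /setUP[/ne1|/ne2].
move=> [x /separating_vertexW[K1 [K2 [sepU K1n0 K2n0]]]].
have [_ eqE capE capV] := sepU.
have apart (A B C D : hypergraph psi) : eset C :&: eset D = set0 ->
    vset C :&: vset D = [set x] -> hypersubgraph A C -> hypersubgraph B D ->
    ~ (eset A :&: eset B != set0 \/ 1 < #|vset A :&: vset B|).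
  move=> CD0 CDx /andP[AC AC'] /andP[BD BD'].
  case=> [|]; first by rewrite -subset0 -CD0 setISS.
  by rewrite ltnNge -(cards1 x) -CDx subset_leq_card // setISS.
have same (C D : hypergraph psi) : eset hypergraph_union = eset C :|: eset D ->
    eset C :&: eset D = set0 -> hypersubgraph B1 C -> hypersubgraph B2 C ->
    eset D = set0.
  move=> eqU CD0 /andP[_ B1C] /andP[_ B2C].
  apply/eqP; rewrite -subset0 -CD0 subsetI subxx andbT.
  apply: subset_trans (_ : eset hypergraph_union \subset _).
    by rewrite eqU subsetUr.
  by rewrite subUset B1C.
case: (nonseparable_side sepU hypersubgraph_unionl ns1) => B1K;
  case: (nonseparable_side sepU hypersubgraph_unionr ns2) => B2K.
- by rewrite (same _ _ eqE capE B1K B2K) eqxx in K2n0.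
- exact: apart capE capV B1K B2K share.
- by apply: apart B1K B2K share; rewrite setIC.
- by rewrite (same K2 K1) ?eqxx 1?setIC // setUC in K1n0.
Qed.

End Union.

(** * Overlap and existence of blocks *)

(** By maximality, both blocks equal their union. *)
Lemma block_common H B1 B2 : block H B1 -> block H B2 ->
  eset B1 :&: eset B2 != set0 \/ 1 < #|vset B1 :&: vset B2| -> B1 = B2.
Proof.
move=> [B1H ns1 max1] [B2H ns2 max2] share.
have nsU := nonseparable_union ns1 ns2 share.
have UH : hypersubgraph (hypergraph_union B1 B2) H.
  case/andP: B1H => ? ?; case/andP: B2H => ? ?.
  by rewrite /hypersubgraph !subUset; apply/andP; split; apply/andP.
rewrite -(max1 _ UH nsU (hypersubgraph_unionl _ _)).
exact: max2 UH nsU (hypersubgraph_unionr _ _).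
Qed.

(** Induction on the number of ambient vertices and edges missing from [K]: if [K] is not a block, a
    strictly larger nonseparable hypersubgraph takes its place. *)
Lemma nonseparable_sub_block H K : hypersubgraph K H -> nonseparable K ->
  exists B, block H B /\ hypersubgraph K B.
Proof.
have [n] := ubnP (#|V| + #|E| - (#|vset K| + #|eset K|)).
elim: n K => // n IHn K ltKn KH nsK.
have [Kmax|] := classic (block H K).
  by exists K; split=> //; apply: hypersubgraph_refl.
move=> notmax; have [K' [K'H nsK' KK' neqK]] : exists K',
    [/\ hypersubgraph K' H, nonseparable K', hypersubgraph K K' & K' <> K].
  apply: NNPP => noK'; apply: notmax; split=> // K' K'H nsK' KK'.
  by apply: NNPP => neqK; apply: noK'; exists K'.
have [|B [HB K'B]] := IHn K' _ K'H nsK'; last first.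
  by exists B; split=> //; apply: hypersubgraph_trans KK' K'B.
have /andP[KV KE] := KK'.
(* Equal sums would force equal cardinals in both components, and the inclusions would then be
   equalities. *)
have ltc : #|vset K| + #|eset K| < #|vset K'| + #|eset K'|.
  rewrite ltn_neqAle leq_add ?subset_leq_card // andbT.
  apply/eqP => eqc; apply: neqK.
  have le1 := subset_leq_card KV; have le2 := subset_leq_card KE.
  have eqV : #|vset K'| <= #|vset K|.
    by rewrite -(leq_add2r #|eset K'|) -eqc leq_add2l.
  have eqE : #|eset K'| <= #|eset K|.
    by rewrite -(leq_add2l #|vset K'|) -eqc leq_add2r.
  by apply: hypergraph_eq; apply/esym/eqP; rewrite eqEcard ?KV ?KE.
apply: leq_trans (ltKn : _ <= n); apply: ltn_sub2l => //.
by apply: leq_trans ltc _; rewrite leq_add ?max_card.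
Qed.

(** * Single vertices and single edges *)

Lemma vertex_eset_sub v :
  [forall e in (set0 : {set E}), psi e \subset [set v]].
Proof. by apply/forall_inP => e; rewrite inE. Qed.

Lemma vertex_vset_neq0 v : [set v] != set0.
Proof. by apply/set0Pn; exists v; rewrite inE. Qed.

Definition vertex_hypergraph v : hypergraph psi :=
  Hypergraph (vertex_vset_neq0 v) (vertex_eset_sub v).

(** Each part of a separation needs an edge, and there is none. This lets blocks cover a vertex on
    no edge, as when [H] is a single vertex. *)
Lemma nonseparable_vertex v : nonseparable (vertex_hypergraph v).
Proof.
split; first by move=> u w /set1P-> /set1P->; rewrite eqxx.
  by move=> e; rewrite inE.
move=> [x /separating_vertexW[K1 [K2 [[_ /= eqE _ _] K1n0 _]]]].
by case/negP: K1n0; rewrite -subset0 eqE subsetUl.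
Qed.

Lemma edge_eset_sub e : [forall f in [set e], psi f \subset psi e].
Proof. by apply/forall_inP => f /set1P->. Qed.

Lemma nonseparable_edge e (en0 : psi e != set0) :
  nonseparable (Hypergraph en0 (edge_eset_sub e)).
Proof.
split; last 1 first.
- move=> [x /separating_vertexW[K1 [K2 [[_ /= eqE capE _]]]]].
  move=> /set0Pn[e1 e1K] /set0Pn[e2 e2K].
  have : e1 \in [set e] by rewrite eqE inE e1K.
  have : e2 \in [set e] by rewrite eqE inE e2K orbT.
  move=> /set1P e2e /set1P e1e; rewrite e1e in e1K; rewrite e2e in e2K.
  by have := in_set0 e; rewrite -capE inE e1K e2K.
- apply/connectedP => S u clS /= ue uS.
  by apply: (clS e u) ue uS; rewrite inE.
- by move=> f /set1P->.
Qed.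

(** * Cycles *)

Section Cycle.
Variable H : hypergraph psi.

Lemma is_walk_cat u s1 s2 : is_walk H u (s1 ++ s2) ->
  is_walk H u s1 /\ is_walk H (walk_end u s1) s2.
Proof.
elim: s1 u => [|[e w] s1 IHs] u /=; last first.
  by move=> /andP[-> /IHs[-> ->]].
case: s2 => [|[e w] s2] //= us; split=> //.
by case/andP: us => /and4P[eH _ /(mem_edge eH)].
Qed.

Lemma is_walk_catI u s1 s2 : is_walk H u s1 ->
  is_walk H (walk_end u s1) s2 -> is_walk H u (s1 ++ s2).
Proof.
by elim: s1 u => [|[e w] s1 IHs] u //= /andP[-> /IHs].
Qed.

(** The start [u] acts as a hub: membership in [S] passes from any edge of the walk back to [u], and
    from [u] to any other edge. *)
Lemma walk_edge_closed u s S e : edge_closed [set f in unzip1 s] S ->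
  is_walk H u s -> e \in unzip1 s ->
  (u \in S -> psi e \subset S) /\ (forall v, v \in psi e -> v \in S -> u \in S).
Proof.
elim: s u => [|[f w] s IHs] u //= clS /andP[/and4P[_ _ uf wf] ws].
have clf v : v \in psi f -> v \in S -> psi f \subset S.
  by apply: clS; rewrite inE mem_head.
rewrite inE => /orP[/eqP->|es].
  by split=> [|v vf vS]; [exact: clf | apply: (subsetP (clf v vf vS))].
have clS' : edge_closed [set g in unzip1 s] S.
  by move=> g v; rewrite inE => gs; apply: clS; rewrite !inE gs orbT.
have [ws1 ws2] := IHs w clS' ws es; split=> [uS|v ve vS].
  by apply: ws1; apply: (subsetP (clf u uf uS)).
by apply: (subsetP (clf w wf (ws2 v ve vS))).
Qed.

(* [belast w (unzip2 s)] lists the inner vertices of the walk [(e, w) :: s]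
   from [u]. *)
Lemma walk_one_side (F1 F2 : {set E}) x u e w s :
  (forall f, f \in unzip1 ((e, w) :: s) -> f \in F1 \/ f \in F2) ->
  (forall f g v, f \in F1 -> g \in F2 -> v \in psi f -> v \in psi g -> v = x) ->
  is_walk H u ((e, w) :: s) -> x \notin belast w (unzip2 s) ->
  e \in F1 -> {subset unzip1 ((e, w) :: s) <= F1}.
Proof.
move=> + meet; elim: s u e w => [|[f y] s IHs] u e w cover.
  by move=> _ _ e1 f /=; rewrite inE => /eqP->.
move=> /= /andP[/and4P[_ _ _ we] wfs]; rewrite inE negb_or => /andP[neq_xw xs] e1.
have f1 : f \in F1.
  have [//|f2] : f \in F1 \/ f \in F2 by apply: cover; rewrite /= !inE eqxx orbT.
  have wf : w \in psi f by case/andP: wfs => /and4P[].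
  by rewrite (meet e f w) ?eqxx in neq_xw.
have side := IHs w f y _ wfs xs f1.
move=> g; rewrite inE => /orP[/eqP->//|]; apply: side.
by move=> g' g's; apply: cover; rewrite /= inE [_ \in _]g's orbT.
Qed.

(** The lists differ by moving [v] from front to back. Distinctness can thus be checked on
    [unzip2 s], which rotates together with the walk. *)
Lemma cycle_perm v s : walk_end v s = v ->
  perm_eq (belast v (unzip2 s)) (unzip2 s).
Proof.
rewrite /walk_end => endv; rewrite -(perm_cons v).
by rewrite -perm_rcons -{2}endv -lastI.
Qed.

Lemma cycle_rot v s x : is_cycle H v s -> x \in unzip2 s ->
  exists2 s', is_cycle H x s' & unzip1 s' =i unzip1 s.
Proof.
move=> /and5P[ws sz /eqP endv Us Ue] /mapP[[e w] es /= xw].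
rewrite -{w}xw in es; case/splitPr: es => s1 s2 in ws sz endv Us Ue *.
(* The cut is made just after the step arriving at [x], so that [s2] starts at [x] and [t] ends
   there. *)
rewrite -cat_rcons in ws sz endv Us Ue *.
set t := rcons s1 _ in ws sz endv Us Ue *.
have endt : walk_end v t = x by rewrite /walk_end /t /unzip2 map_rcons last_rcons.
have end_cat u a b : walk_end u (a ++ b) = walk_end (walk_end u a) b.
  by rewrite /walk_end /unzip2 map_cat last_cat.
have [wt ws2] := is_walk_cat ws; rewrite endt in ws2.
have end2 : walk_end x s2 = v by rewrite -endt -end_cat.
have endx : walk_end x (s2 ++ t) = x by rewrite end_cat end2.
exists (s2 ++ t); last by move=> f; rewrite /unzip1 !map_cat !mem_cat orbC.
apply/and5P; split.
- by apply: is_walk_catI => //; rewrite end2.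
- by rewrite size_cat addnC -size_cat.
- exact/eqP.
- rewrite (perm_uniq (cycle_perm endx)) /unzip2 map_cat uniq_catC -map_cat.
  by rewrite -(perm_uniq (cycle_perm endv)).
- by rewrite /unzip1 map_cat uniq_catC -map_cat.
Qed.

(* Starting the cycle at [x] when it visits [x] keeps [x] off its inner
   vertices. *)
Lemma cycle_one_side (F1 F2 : {set E}) x v s : is_cycle H v s ->
  (forall f, f \in unzip1 s -> f \in F1 \/ f \in F2) ->
  (forall f g v, f \in F1 -> g \in F2 -> v \in psi f -> v \in psi g -> v = x) ->
  {subset unzip1 s <= F1} \/ {subset unzip1 s <= F2}.
Proof.
move=> cs cover meet.
have [u [e [w [s' [ws' eqs xs']]]]] : exists u e w s',
    [/\ is_walk H u ((e, w) :: s'), unzip1 ((e, w) :: s') =i unzip1 s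
      & x \notin belast w (unzip2 s')].
  have [xs|xs] := boolP (x \in unzip2 s).
    have [[|[e w] s'] /and5P[ws' sz _ Us _] eqs] := cycle_rot cs xs => //.
    (* For the rotated cycle [Us] is distinctness of [x :: belast w (unzip2 s')], whose head gives
       the condition on [x]. *)
    by exists x, e, w, s'; split=> //; case/andP: Us.
  case/and5P: cs xs {cover}; case: s => [|[e w] s] // ws _ _ _ _ xs.
  by exists v, e, w, s; split=> //; apply: contra xs; apply: mem_belast.
have cover' f : f \in unzip1 ((e, w) :: s') -> f \in F1 \/ f \in F2.
  by rewrite eqs; apply: cover.
have [e1|e2] := cover' e (mem_head _ _); [left|right] => f; rewrite -eqs.
  exact: walk_one_side cover' meet ws' xs' e1 f.
apply: (walk_one_side (F2 := F1)) _ _ ws' xs' e2 f => [g /cover'[]|g h y g2 h1 yg yh].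
- by right.
- by left.
- exact: meet h1 g2 yh yg.
Qed.

Variable C : cycle_of H.

Lemma cycle_hypergraph_sub : hypersubgraph (cycle_hypergraph C) H.
Proof.
have CE : cycle_eset C \subset eset H.
  apply/subsetP => e; rewrite inE; case: C => v s /= /and5P[+ _ _ _ _].
  elim: s v => [|[f w] s IHs] v //= /andP[/and4P[fH _ _ _] /IHs es].
  by rewrite inE => /orP[/eqP->|/es].
rewrite /hypersubgraph CE andbT; apply/bigcupsP => e eC.
by rewrite edge_subset // (subsetP CE).
Qed.

Lemma connected_cycle : connected (cycle_hypergraph C).
Proof.
apply/connectedP => S u clS /= /bigcupP[e eC ue] uS.
apply/bigcupsP => f fC; have /and5P[ws _ _ _ _] := cycle_ofP C.
rewrite !inE in eC fC.
have [_ startS] := walk_edge_closed clS ws eC.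
have [+ _] := walk_edge_closed clS ws fC.
by apply; apply: startS ue uS.
Qed.

Lemma nonseparable_cycle : no_empty_edges H -> nonseparable (cycle_hypergraph C).
Proof.
move=> neH; split; first exact: connected_cycle.
  by case/andP: cycle_hypergraph_sub => _ /subsetP CE e /CE/neH.
move=> [x /separating_vertexW[K1 [K2 [sepC K1n0 K2n0]]]].
have [_ /= eqE capE _] := sepC.
have in_cycle f : f \in eset K1 :|: eset K2 <-> f \in unzip1 (cycle_steps C).
  by rewrite -eqE inE.
have sideE f : f \in unzip1 (cycle_steps C) -> f \in eset K1 \/ f \in eset K2.
  by move=> fC; apply/setUP/in_cycle.
have meet f g v : f \in eset K1 -> g \in eset K2 ->
    v \in psi f -> v \in psi g -> v = x.
  move=> f1 g2 vf vg.
  exact (separation_meet sepC (mem_edge f1 vf) (mem_edge g2 vg)).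
(* The part that does not receive the cycle would have an edge in common with the other. *)
have [sub|sub] := cycle_one_side (cycle_ofP C) sideE meet.
  case/set0Pn: K2n0 => f f2.
  have f1 : f \in eset K1.
    by apply/sub/(proj1 (in_cycle f)); rewrite inE f2 orbT.
  by have := in_set0 f; rewrite -capE inE f1 f2.
case/set0Pn: K1n0 => f f1.
have f2 : f \in eset K2.
  by apply/sub/(proj1 (in_cycle f)); rewrite inE f1.
by have := in_set0 f; rewrite -capE inE f1 f2.
Qed.

End Cycle.

End Blocks.

Theorem theorem3p37 (V E : finType) (psi : E -> {set V}) (H : hypergraph psi)
    (Hconn : connected H) (Hne : no_empty_edges H) :
  [/\ forall B1 B2 : hypergraph psi, block H B1 -> block H B2 -> B1 <> B2 ->
        eset B1 :&: eset B2 = set0 /\ #|vset B1 :&: vset B2| <= 1,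
      decomposition H (block H)
    & forall C : cycle_of H,
        exists B : hypergraph psi,
          block H B /\ hypersubgraph (cycle_hypergraph C) B].
Proof.
have edge_block e : e \in eset H -> exists B, block H B /\ e \in eset B.
  move=> eH; have en0 := Hne e eH.
  have [|B [HB /andP[_ eB]]] :=
    nonseparable_sub_block (H := H) _ (nonseparable_edge en0).
    by rewrite /hypersubgraph /= edge_subset // sub1set.
  by exists B; split=> //; rewrite -sub1set.
have vertex_block v : v \in vset H -> exists B, block H B /\ v \in vset B.
  move=> vH.
  have [|B [HB /andP[vB _]]] :=
    nonseparable_sub_block (H := H) _ (nonseparable_vertex v).
    by rewrite /hypersubgraph /= sub1set vH sub0set.
  by exists B; split=> //; rewrite -sub1set.
split.
- move=> B1 B2 HB1 HB2 neqB; split.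
    apply/eqP/negPn/negP => share; apply: neqB.
    by apply: block_common HB1 HB2 _; left.
  rewrite leqNgt; apply/negP => share; apply: neqB.
  by apply: block_common HB1 HB2 _; right.
- split=> [B [] //|e eH|v|e].
  + have [B [HB eB]] := edge_block e eH; exists B; split=> // B' [HB' eB'].
    apply: block_common HB HB' _; left; apply/set0Pn; exists e.
    by rewrite inE eB.
  + split=> [/vertex_block //|[B [[/andP[/subsetP BH _] _ _] /BH]]] //.
  + split=> [/edge_block //|[B [[/andP[_ /subsetP BH] _ _] /BH]]] //.
- move=> C; apply: nonseparable_sub_block; first exact: cycle_hypergraph_sub.
  exact: nonseparable_cycle.
Qed.
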